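(* Let $n\ge 1$, let $\boldsymbol{a},\boldsymbol{b}\in\mathbb{R}^n$ with $a_i<b_i$ for all $i$, and let $f:[\boldsymbol{a},\boldsymbol{b}]\to\mathbb{R}$ be a function on the rectangle $[\boldsymbol{a},\boldsymbol{b}]=\prod_{i=1}^n[a_i,b_i]$. Then $f$ is of bounded variation on $[\boldsymbol{a},\boldsymbol{b}]$ if and only if there exist two jointly monotone increasing functions $g,h:[\boldsymbol{a},\boldsymbol{b}]\to\mathbb{R}$ such that $f(\boldsymbol{x})=g(\boldsymbol{x})-h(\boldsymbol{x})$ for every $\boldsymbol{x}\in[\boldsymbol{a},\boldsymbol{b}]$.
   Context: For $\boldsymbol{c},\boldsymbol{d}\in\mathbb{R}^n$, $\boldsymbol{c}\le\boldsymbol{d}$ means $c_i\le d_i$ for all $i$, and $[\boldsymbol{c},\boldsymbol{d}]=\prod_i[c_i,d_i]$. The joint increment of $f$ over $[\boldsymbol{c},\boldsymbol{d}]$ is $$\Delta_f^n[\boldsymbol{c},\boldsymbol{d}]=\sum_{\epsilon_1,\dots,\epsilon_n\in\{0,1\}}(-1)^{n+\epsilon_1+\dots+\epsilon_n}f\big(c_1+\epsilon_1(d_1-c_1),\dots,c_n+\epsilon_n(d_n-c_n)\big).$$ A function $g$ is jointly monotone increasing on $[\boldsymbol{a},\boldsymbol{b}]$ if $\Delta_g^n[\boldsymbol{x},\boldsymbol{y}]\ge 0$ for all $\boldsymbol{x}\le\boldsymbol{y}$ in $[\boldsymbol{a},\boldsymbol{b}]$. The total variation of $f$ on $[\boldsymbol{a},\boldsymbol{b}]$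 is $$\bigvee_{\boldsymbol{a}}^{\boldsymbol{b}}(f)=\sup_{\Delta}\sum_{i=1}^{N^n}|\Delta_f^nI_i|,$$ where the supremum is over all $N\ge1$ and all grid partitions $\Delta: a_i=x_{i0}<x_{i1}<\dots<x_{iN}=b_i$ ($i=1,\dots,n$), and $I_1,\dots,I_{N^n}$ are the closed sub-rectangles generated by $\Delta$. $f$ is of bounded variation on $[\boldsymbol{a},\boldsymbol{b}]$ if $\bigvee_{\boldsymbol{a}}^{\boldsymbol{b}}(f)<+\infty$. *)

(* Defs.v *)
From mathcomp Require Import all_boot all_order all_algebra.
From mathcomp Require Import all_classical all_reals ereal.

Set Implicit Arguments.
Unset Strict Implicit.
Unset Printing Implicit Defensive.
Import Order.TTheory GRing.Theory Num.Theory.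
Local Open Scope classical_set_scope.
Local Open Scope ring_scope.

(* A point of R^n is a row vector.  A function on the rectangle [a, b] is a
   total function on R^n of which every notion below only inspects the values
   on [a, b]. *)

Section JointVariation.
Context {R : realType} {n : nat}.
Implicit Types (a b c d x y : 'rV[R]_n) (f g : 'rV[R]_n -> R).

Definition vec_le c d : Prop := forall i : 'I_n, c 0 i <= d 0 i.

Definition rect c d : set 'rV[R]_n :=
  [set x | forall i : 'I_n, c 0 i <= x 0 i <= d 0 i].

(* The booleans [eps i] are read as 0 or 1. *)
Definition joint_increment f c d : R :=
  \sum_(eps : {ffun 'I_n -> bool})
    (-1) ^+ (n + \sum_(i < n) eps i) *
    f (\row_(i < n) (c 0 i + (eps i)%:R * (d 0 i - c 0 i))).

Definition jointly_increasing a b g : Prop :=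
  forall x y, rect a b x -> rect a b y -> vec_le x y ->
    0 <= joint_increment g x y.

(* [X i j] is the j-th division point on the i-th axis, for [j <= N]; its
   values for [j > N] are irrelevant.  All axes have the same number [N] of
   subintervals. *)
Definition grid_partition a b (N : nat) (X : 'I_n -> nat -> R) : Prop :=
  forall i : 'I_n, [/\ X i 0%N = a 0 i, X i N = b 0 i &
    forall j : nat, (j < N)%N -> X i j < X i j.+1].

(* The N^n cells of the grid are indexed by the functions [k], the cell of [k]
   being the product over i of the intervals [X i (k i), X i (k i + 1)]. *)
Definition grid_variation f (N : nat) (X : 'I_n -> nat -> R) : R :=
  \sum_(k : {ffun 'I_n -> 'I_N})
    `| joint_increment f (\row_(i < n) X i (k i)) (\row_(i < n) X i (k i).+1) |.

Definition joint_total_variation a b f : \bar R :=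
  ereal_sup [set v : \bar R | exists (N : nat) (X : 'I_n -> nat -> R),
    [/\ (1 <= N)%N, grid_partition a b N X & v = (grid_variation f N X)%:E]].

Definition joint_bounded_variation a b f : Prop :=
  (joint_total_variation a b f < +oo)%E.

End JointVariation.

(* Main.v *)
(* The joint increment over a grid rectangle is the sum of the increments over
   its cells, so a difference of two jointly increasing functions has variation
   at most the sum of their increments over [a, b].  Conversely, for a grid X
   let g_X(x) be the sum of the positive parts of the increments of f over the
   cells whose upper corner is <= x.  Then 0 <= g_X <= V(f), g_X is jointly
   increasing, and its increment over [x, y] dominates that of f as soon as x
   and y are grid points.  A limit g of the g_X along an ultrafilter on grids
   that eventually contain any given point inherits these inequalities, so both
   g and g - f are jointly increasing. *)
Require Import Defs.
From mathcomp Require Import all_boot all_order all_algebra.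
From mathcomp Require Import all_classical all_reals ereal topology normedtype.

Set Implicit Arguments.
Unset Strict Implicit.
Unset Printing Implicit Defensive.
Import Order.TTheory GRing.Theory Num.Theory.
Import numFieldNormedType.Exports.
Local Open Scope classical_set_scope.
Local Open Scope ring_scope.

(** * Joint increments and their algebra *)

Section Increment.
Context {R : realType} {n : nat}.
Implicit Types (a b c d x y z : 'rV[R]_n) (f g : 'rV[R]_n -> R).

Definition corner c d (eps : {ffun 'I_n -> bool}) : 'rV[R]_n :=
  \row_i (if eps i then d 0 i else c 0 i).

(** The sign factors over the axes: [n] is a sum of ones, so axis [i] contributes
    [(-1) ^+ (1 + eps i)]. *)
Lemma joint_incrementE f c d :
  joint_increment f c d =
  \sum_(eps : {ffun 'I_n -> bool})
    (\prod_i (if eps i then 1 else -1)) * f (corner c d eps).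
Proof.
apply: eq_bigr => eps _; congr (_ * f _).
  rewrite -[X in (X + _)%N]card_ord -sum1_card -big_split -prodrXr.
  by apply: eq_bigr => i _; case: (eps i); rewrite ?expr1 // -signr_odd.
apply/rowP => i; rewrite !mxE; case: (eps i) => /=.
  by rewrite mul1r subrKC.
by rewrite mul0r addr0.
Qed.

Lemma corner_rect c d eps : vec_le c d -> rect c d (corner c d eps).
Proof.
by move=> cd i; rewrite mxE; case: ifP => _; rewrite lexx cd.
Qed.

Lemma eq_joint_increment f g c d :
  (forall eps, f (corner c d eps) = g (corner c d eps)) ->
  joint_increment f c d = joint_increment g c d.
Proof.
by move=> fg; rewrite !joint_incrementE; under eq_bigr do rewrite fg.
Qed.

Lemma joint_incrementB f g c d :
  joint_increment (fun z => f z - g z) c d =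
  joint_increment f c d - joint_increment g c d.
Proof. by rewrite -sumrB; apply: eq_bigr => eps _; rewrite mulrBr. Qed.

Lemma joint_increment_lincomb (I : finType) (w : I -> R)
    (F : I -> 'rV[R]_n -> R) c d :
  joint_increment (fun z => \sum_k w k * F k z) c d =
  \sum_k w k * joint_increment (F k) c d.
Proof.
rewrite /joint_increment; under eq_bigr do rewrite mulr_sumr.
rewrite exchange_big; apply: eq_bigr => k _ /=.
by rewrite mulr_sumr; apply: eq_bigr => eps _; rewrite mulrCA.
Qed.

(** By distributivity, expanding the product of differences yields one signed term per vertex. *)
Lemma joint_increment_prod (phi : 'I_n -> R -> R) c d :
  joint_increment (fun z => \prod_i phi i (z 0 i)) c d =
  \prod_i (phi i (d 0 i) - phi i (c 0 i)).
Proof.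
rewrite joint_incrementE.
pose F i (e : bool) :=
  (if e then 1 else -1) * phi i (if e then d 0 i else c 0 i).
transitivity (\prod_i \sum_e F i e).
  rewrite bigA_distr_bigA /=; apply: eq_bigr => eps _.
  by rewrite -big_split; apply: eq_bigr => i _; rewrite mxE.
by apply: eq_bigr => i _; rewrite big_bool /F mul1r mulN1r.
Qed.

Definition on_grid (N : nat) (X : 'I_n -> nat -> R) x :=
  exists2 l : 'I_n -> nat, (forall i, l i <= N)%N & x = \row_i X i (l i).

(** The condition on the upper corner is written as a product of one-variable indicators so that
    [joint_increment_prod] applies to it. *)
Definition grid_positive_variation f (N : nat) (X : 'I_n -> nat -> R) x : R :=
  \sum_(k : {ffun 'I_n -> 'I_N})
    Num.max 0 (joint_increment f (\row_i X i (k i)) (\row_i X i (k i).+1)) *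
    \prod_i (X i (k i).+1 <= x 0 i)%R%:R.

End Increment.

(** The range is a factor rather than a summation bound, so that a sum over all cells can be
    distributed over the axes. *)
Lemma telescope_sum_ord (V : pzRingType) (N l u : nat) (psi : nat -> V) :
  (l <= u <= N)%N ->
  \sum_(k < N) (l <= k < u)%:R * (psi k.+1 - psi k) = psi u - psi l.
Proof.
move=> /andP[lu uN]; rewrite -(telescope_sumr _ lu).
rewrite (big_nat_widenl _ 0) // (big_nat_widen _ _ N) // big_mkord.
rewrite [RHS]big_mkcond; apply: eq_bigr => k _ /=.
by case: ifP => _; rewrite ?mul1r ?mul0r.
Qed.

(** * Increments over the cells of a fixed grid *)

Section Grid.
Context {R : realType} {n : nat}.
Implicit Types (a b c d x y z : 'rV[R]_n) (f g : 'rV[R]_n -> R).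
Context {a b : 'rV[R]_n} {N : nat} {X : 'I_n -> nat -> R}.
Hypothesis gridX : grid_partition a b N X.

Lemma grid_lt i :
  {in [pred j | (j <= N)%N] &, {mono X i : j k / (j < k)%N >-> j < k}}.
Proof.
have [_ _ Xlt] := gridX i.
have Xhomo :
    {in [pred j | (j <= N)%N] &, {homo X i : j k / (j < k)%N >-> j < k}}.
  apply: homo_ltn_in; first exact: lt_trans.
    by move=> j k _ + l /andP[_ /ltnW lk]; rewrite !inE; exact: leq_trans.
  by move=> j _ jN; apply: Xlt.
move=> j k jN kN; case: (ltngtP j k) => [|kj|->]; last by rewrite ltxx.
  exact: Xhomo.
by apply/negbTE; rewrite -leNgt ltW// Xhomo.
Qed.

Lemma grid_le i :
  {in [pred j | (j <= N)%N] &, {mono X i : j k / (j <= k)%N >-> j <= k}}.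
Proof. by move=> j k jN kN; rewrite [LHS]leNgt grid_lt// -leqNgt. Qed.

Lemma grid_eq i :
  {in [pred j | (j <= N)%N] &, forall j k, (X i j == X i k) = (j == k)}.
Proof. by move=> j k jN kN; rewrite eq_le !grid_le// eqn_leq. Qed.

Lemma grid_rect (p : 'I_n -> nat) :
  (forall i, p i <= N)%N -> rect a b (\row_i X i (p i)).
Proof.
move=> pN i; rewrite mxE; have [<- <- _] := gridX i.
by rewrite !grid_le ?inE //= pN.
Qed.

(* On grid points [f] coincides with a combination of products of
   one-variable functions, for which the sum over the cells is a product of
   telescoping sums. *)
Lemma grid_additivity f (l u : 'I_n -> nat) :
  (forall i, l i <= u i <= N)%N ->
  \sum_(k : {ffun 'I_n -> 'I_N}) (\prod_i (l i <= k i < u i)%:R) *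
     joint_increment f (\row_i X i (k i)) (\row_i X i (k i).+1) =
  joint_increment f (\row_i X i (l i)) (\row_i X i (u i)).
Proof.
move=> luN.
pose node (j : {ffun 'I_n -> 'I_N.+1}) : 'rV[R]_n := \row_i X i (j i).
pose psi (j : {ffun 'I_n -> 'I_N.+1}) i m : R := (X i (j i) == X i m)%:R.
have incE (p q : 'I_n -> nat) :
    (forall i, p i <= N)%N -> (forall i, q i <= N)%N ->
    joint_increment f (\row_i X i (p i)) (\row_i X i (q i)) =
    \sum_j f (node j) * \prod_i (psi j i (q i) - psi j i (p i)).
  move=> pN qN.
  (* [f] is interpolated by the indicators of the nodes; the two functions agree at every vertex,
     since each vertex is a node. *)
  transitivity (joint_increment (fun z => \sum_j f (node j) *
      \prod_i (X i (j i) == z 0 i)%:R) (\row_i X i (p i)) (\row_i X i (q i))).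
    apply: eq_joint_increment => eps.
    pose r i := if eps i then q i else p i.
    have rN i : (r i <= N)%N by rewrite /r; case: ifP.
    pose j0 : {ffun 'I_n -> 'I_N.+1} := [ffun i => inord (r i)].
    have j0E i : j0 i = r i :> nat by rewrite ffunE inordK ?ltnS.
    have cE i :
        corner (\row_i X i (p i)) (\row_i X i (q i)) eps 0 i = X i (j0 i).
      by rewrite !mxE j0E /r; case: ifP.
    rewrite (bigD1 j0)//= [X in _ = _ + X]big1 ?addr0 => [|j jj0].
      rewrite big1 ?mulr1 => [|i _]; last by rewrite cE eqxx.
      by congr f; apply/rowP => i; rewrite cE mxE.
    (* Any other node differs from the vertex on some axis, where its indicator vanishes. *)
    have [i ji] : exists i, j i != j0 i.
      apply/existsP; apply: contraNT jj0 => /existsPn jj0.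
      by apply/eqP/ffunP => i; apply/eqP; rewrite -[_ == _]negbK.
    rewrite (bigD1 i)//= cE grid_eq ?inE -1?ltnS//.
    by rewrite (inj_eq val_inj) (negbTE ji) mul0r mulr0.
  rewrite joint_increment_lincomb; apply: eq_bigr => j _; congr (_ * _).
  rewrite (joint_increment_prod (fun i t => (X i (j i) == t)%:R)).
  by apply: eq_bigr => i _; rewrite !mxE.
rewrite incE; try by move=> i; case/andP: (luN i) => // /leq_trans; apply.
under eq_bigr => k _.
  rewrite incE; try by move=> i; rewrite // ltnW.
  rewrite mulr_sumr; over.
rewrite exchange_big; apply: eq_bigr => j _ /=.
under eq_bigr do rewrite mulrCA -big_split /=.
rewrite -mulr_sumr; congr (_ * _).
pose G i (k : 'I_N) : R :=
  (l i <= k < u i)%:R * (psi j i k.+1 - psi j i k).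
rewrite -(bigA_distr_bigA G).
by apply: eq_bigr => i _; rewrite telescope_sum_ord.
Qed.

Lemma grid_total f :
  \sum_(k : {ffun 'I_n -> 'I_N})
     joint_increment f (\row_i X i (k i)) (\row_i X i (k i).+1) =
  joint_increment f a b.
Proof.
have -> : a = \row_i X i 0%N.
  by apply/rowP => i; rewrite mxE; case: (gridX i).
have -> : b = \row_i X i N.
  by apply/rowP => i; rewrite mxE; case: (gridX i).
rewrite -(@grid_additivity f (fun=> 0%N) (fun=> N)); last by rewrite leqnn.
by apply: eq_bigr => k _; rewrite big1 ?mul1r// => i _; rewrite ltn_ord.
Qed.

Lemma grid_cell_le (k : {ffun 'I_n -> 'I_N}) :
  vec_le (\row_i X i (k i)) (\row_i X i (k i).+1).
Proof. by move=> i; rewrite !mxE grid_le ?inE//= ltnW. Qed.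

(** Being uniform in [x], this keeps the approximations in a compact interval once the total
    variation is finite. *)
Lemma grid_positive_variation_bound f x :
  0 <= grid_positive_variation f N X x <= grid_variation f N X.
Proof.
apply/andP; split.
  apply: sumr_ge0 => k _; rewrite mulr_ge0 ?le_max ?lexx//.
  by apply: prodr_ge0 => i _; rewrite ler0n.
apply: ler_sum => k _; rewrite -[leRHS]mulr1 ler_pM ?le_max ?lexx//.
- by apply: prodr_ge0 => i _; rewrite ler0n.
- by rewrite ge_max normr_ge0 ler_norm.
- by apply: prodr_ile1 => i _; rewrite ler0n lern1 leq_b1.
Qed.

Lemma joint_increment_grid_positive_variation f x y :
  joint_increment (grid_positive_variation f N X) x y =
  \sum_(k : {ffun 'I_n -> 'I_N})
    Num.max 0 (joint_increment f (\row_i X i (k i)) (\row_i X i (k i).+1)) *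
    \prod_i ((X i (k i).+1 <= y 0 i)%R%:R - (X i (k i).+1 <= x 0 i)%R%:R).
Proof.
rewrite joint_increment_lincomb; apply: eq_bigr => k _; congr (_ * _).
exact: (joint_increment_prod (fun i t => (X i (k i).+1 <= t)%R%:R)).
Qed.

(** Each indicator is nondecreasing in its coordinate, so every factor of the product formula is
    nonnegative. *)
Lemma joint_increment_grid_positive_variation_ge0 f x y :
  vec_le x y -> 0 <= joint_increment (grid_positive_variation f N X) x y.
Proof.
move=> xy; rewrite joint_increment_grid_positive_variation.
apply: sumr_ge0 => k _; rewrite mulr_ge0 ?le_max ?lexx//.
apply: prodr_ge0 => i _; rewrite subr_ge0 ler_nat.
by case: (leP _ (x 0 i)) => // /le_trans -> //.
Qed.

(** Between grid points the differences of indicators select exactly the cells inside [[x, y]], so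
    additivity reduces the claim to [t <= Num.max 0 t] on each cell. *)
Lemma joint_increment_grid_positive_variation_ge f x y :
  on_grid N X x -> on_grid N X y -> vec_le x y ->
  joint_increment f x y <= joint_increment (grid_positive_variation f N X) x y.
Proof.
move=> [l lN xE] [u uN yE]; subst x y => xy.
have luN i : (l i <= u i <= N)%N.
  by rewrite uN andbT -(@grid_le i) ?inE//; have := xy i; rewrite !mxE.
rewrite -grid_additivity// joint_increment_grid_positive_variation.
apply: ler_sum => k _.
(* For [m <= N], [X i (k i).+1 <= X i m] means [k i < m]; since [l i <= u i], the difference is the
   indicator of [l i <= k i < u i]. *)
have -> : \prod_i (l i <= k i < u i)%:R =
    \prod_i ((X i (k i).+1 <= X i (u i))%R%:R -
             (X i (k i).+1 <= X i (l i))%R%:R) :> R.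
  apply: eq_bigr => i _; rewrite !grid_le ?inE// [(l i <= _)%N]leqNgt.
  case: (ltnP (k i) (l i)) => [kl|_]; last by rewrite subr0.
  by rewrite (leq_trans kl) ?subrr//; case/andP: (luN i).
under [in leRHS]eq_bigr do rewrite !mxE.
rewrite mulrC ler_wpM2r ?le_max ?lexx ?orbT//.
apply: prodr_ge0 => i _; rewrite subr_ge0 ler_nat.
by case: (leP _ (X i (l i))) => // /le_trans -> //; have := xy i; rewrite !mxE.
Qed.

End Grid.

(** * Refining a grid through given points *)

(* Every axis must gain exactly one node to keep a common [N], so a midpoint is
   inserted when [t] is already a node. *)
Lemma grid_insert_axis (R : realFieldType) (N : nat) (u : nat -> R) (t : R) :
  (0 < N)%N -> (forall j, (j < N)%N -> u j < u j.+1) -> u 0%N <= t <= u N ->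
  exists v : nat -> R,
    [/\ v 0%N = u 0%N /\ v N.+1 = u N,
        forall j, (j < N.+1)%N -> v j < v j.+1,
        forall j, (j <= N)%N -> exists2 k, (k <= N.+1)%N & u j = v k &
        exists2 k, (k <= N.+1)%N & t = v k].
Proof.
move=> N0 uS /andP[u0t tuN].
have [m mN /andP[umt tum]] : exists2 m, (m < N)%N & u m <= t <= u m.+1.
  elim: N N0 tuN {uS} => // N IH _ tuN.
  have [tuN'|uNt] := leP t (u N); last by exists N; rewrite // (ltW uNt).
  case: N IH tuN tuN' => [_ tu1 _|N IH _ tuN'].
    by exists 0%N; rewrite // u0t.
  by have [m mN um] := IH isT tuN'; exists m; rewrite // ltnW.
pose w := if (u m < t) && (t < u m.+1) then t else (u m + u m.+1) / 2.
have /andP[umw wum] : u m < w < u m.+1.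
  by rewrite /w; case: ifP => // _; rewrite midf_lt//= ?uS// midf_lt ?uS.
(* [w] takes the index [m.+1] and the later nodes shift by one. *)
pose v k := if (k <= m)%N then u k else if k == m.+1 then w else u k.-1.
have v_le k : (k <= m)%N -> v k = u k by rewrite /v => ->.
have v_eq : v m.+1 = w by rewrite /v ltnn eqxx.
have v_gt k : (m < k)%N -> v k.+1 = u k.
  by move=> mk; rewrite /v leqNgt ltnS ltnW//= eqSS gtn_eqF.
have uv j : (j <= N)%N -> exists2 k, (k <= N.+1)%N & u j = v k.
  move=> jN; case: (leqP j m) => jm.
    by exists j; rewrite ?v_le// ltnW.
  by exists j.+1; rewrite ?v_gt.
exists v; split => //.
- by rewrite v_le// v_gt.
- move=> j; rewrite ltnS => jN; case: (ltngtP j m) => jm.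
  + by rewrite !v_le ?uS ?(ltn_trans jm mN)// ltnW.
  + case: j jm jN => // j; rewrite ltnS leq_eqVlt => /predU1P[<-|mj] jN.
      by rewrite v_eq v_gt.
    by rewrite !v_gt ?uS// ltnW.
  + by rewrite jm v_le// v_eq.
- have [utm|] := boolP ((u m < t) && (t < u m.+1)).
    by exists m.+1; [rewrite ltnS ltnW|rewrite v_eq /w utm].
  (* Here [t] is an endpoint of its subinterval, hence an old node. *)
  rewrite negb_and -!leNgt => /orP[tm|mt].
    have -> : t = u m by apply/le_anti; rewrite tm.
    by apply: uv; rewrite ltnW.
  by have -> : t = u m.+1 by [apply/le_anti; rewrite mt tum]; apply: uv.
Qed.

Section Refinement.
Context {R : realType} {n : nat} (a b : 'rV[R]_n).
Hypothesis ab : forall i, a 0 i < b 0 i.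
Implicit Types (x y z : 'rV[R]_n).

Lemma grid_insert N X x : (0 < N)%N -> grid_partition a b N X -> rect a b x ->
  exists Y, [/\ grid_partition a b N.+1 Y, on_grid N.+1 Y x &
    forall z, on_grid N X z -> on_grid N.+1 Y z].
Proof.
move=> N0 gridX abx.
have /choice[Y YP] i : exists v : nat -> R,
    [/\ v 0%N = X i 0%N /\ v N.+1 = X i N,
      forall j, (j < N.+1)%N -> v j < v j.+1,
      forall j, (j <= N)%N -> exists2 k, (k <= N.+1)%N & X i j = v k &
      exists2 k, (k <= N.+1)%N & x 0 i = v k].
  by have [Xa Xb XS] := gridX i; apply: grid_insert_axis; rewrite // Xa Xb.
exists Y; split=> [i||z [l lN ->]].
- by have [[-> ->] YS _ _] := YP i; have [-> -> _] := gridX i.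
- have /choice[k kP] i : exists k, (k <= N.+1)%N /\ x 0 i = Y i k.
    by have [_ _ _ [k kN xE]] := YP i; exists k.
  exists k => [i|]; first by case: (kP i).
  by apply/rowP => i; rewrite mxE; case: (kP i).
- have /choice[k kP] i : exists k, (k <= N.+1)%N /\ X i (l i) = Y i k.
    by have [_ _ /(_ _ (lN i))[k kN xE] _] := YP i; exists k.
  exists k => [i|]; first by case: (kP i).
  by apply/rowP => i; rewrite !mxE; case: (kP i).
Qed.

(** The points are inserted one by one into the one-cell grid. This is what makes the filter on
    grids proper. *)
Lemma grid_through (s : seq 'rV[R]_n) : {in s, forall x, rect a b x} ->
  exists N X, [/\ (0 < N)%N, grid_partition a b N X &
    {in s, forall x, on_grid N X x}].
Proof.
elim: s => [_|x s IH sab].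
  exists 1%N, (fun i j => if j is 0%N then a 0 i else b 0 i).
  by split=> // i; split=> // -[].
have [z zs|N [X [N0 gridX Xs]]] := IH.
  by apply: sab; rewrite inE zs orbT.
have [|Y [gridY Yx YX]] := grid_insert N0 gridX (x := x).
  by apply: sab; rewrite inE eqxx.
exists N.+1, Y; split=> // z; rewrite inE => /predU1P[->//|zs].
exact/YX/Xs.
Qed.

End Refinement.

(** * Limits along ultrafilters *)

(** The image of an ultrafilter is again an ultrafilter, and an ultrafilter containing a compact
    segment converges. *)
Lemma ultra_bounded_cvg (R : realType) (T : Type) (G : set_system T)
    (phi : T -> R) (c d : R) : UltraFilter G ->
  (\forall t \near G, c <= phi t <= d) ->
  exists l : R, phi t @[t --> G] --> l.
Proof.
move=> GU Gphi.
have phiU : UltraFilter (phi t @[t --> G]).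
  split=> [|H HF GH]; first exact: fmap_proper_filter.
  rewrite predeqE => A; split=> [HA|]; last exact: GH.
  (* If the preimage of [A] were not in [G], its complement would be, and [H] would contain both [A]
     and the complement of [A]. *)
  have [//|GA] := in_ultra_setVsetC (phi @^-1` A) GU.
  have /GH HA' : (phi t @[t --> G]) (~` A) by [].
  by have := filterI HA HA'; rewrite setICr => /(_ _)/filter_not_empty.
have := @segment_compact R c d; rewrite compact_ultra => /(_ _ phiU)[].
  by apply: filterS Gphi => t; rewrite /= in_itv.
by move=> l [_ phil]; exists l.
Qed.

(** * The two directions of the decomposition *)

Section Jordan.
Context {R : realType} {n : nat} (a b : 'rV[R]_n).
Hypothesis ab : forall i, a 0 i < b 0 i.
Implicit Types (f g h : 'rV[R]_n -> R).

Lemma bounded_variation_of_difference f g h :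
  jointly_increasing a b g -> jointly_increasing a b h ->
  (forall x, rect a b x -> f x = g x - h x) -> joint_bounded_variation a b f.
Proof.
move=> incg inch fE.
pose M := joint_increment g a b + joint_increment h a b.
apply: (@le_lt_trans _ _ M%:E); last by rewrite ltry.
apply: ge_ereal_sup => _ [N [X [_ gridX ->]]]; rewrite lee_fin.
rewrite /M -!(grid_total gridX) -big_split; apply: ler_sum => k _ /=.
set c := (\row_i X i (k i)); set d := (\row_i X i (k i).+1).
have cd : vec_le c d := grid_cell_le gridX k.
have cP : rect a b c by apply: (grid_rect gridX) => i; rewrite ltnW.
have dP : rect a b d by apply: (grid_rect gridX (p := fun i => (k i).+1)) => i.
(* [f = g - h] is known only on [[a, b]], so the vertices of the cell have to be located there. *)
have -> : joint_increment f c d = joint_increment g c d - joint_increment h c d.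
  rewrite -joint_incrementB; apply: eq_joint_increment => eps; apply: fE.
  move=> i; have /andP[cl cu] := corner_rect eps cd i.
  have /andP[ac _] := cP i; have /andP[_ db] := dP i.
  by rewrite (le_trans ac cl) (le_trans cu db).
by rewrite (le_trans (ler_normB _ _))// !ger0_norm ?incg ?inch.
Qed.

(** The maximum packs two inequalities: one makes [g] jointly increasing, the other [g - f]. *)
Lemma positive_variation_exists f : joint_bounded_variation a b f ->
  exists g, forall x y, rect a b x -> rect a b y -> vec_le x y ->
    Num.max 0 (joint_increment f x y) <= joint_increment g x y.
Proof.
move=> bvf.
pose T := (nat * ('I_n -> nat -> R))%type.
pose D : set (seq 'rV[R]_n) := [set s | {in s, forall x, rect a b x}].
pose B (s : seq 'rV[R]_n) : set T :=
  [set NX | [/\ (0 < NX.1)%N, grid_partition a b NX.1 NX.2 &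
    {in s, forall x, on_grid NX.1 NX.2 x}]].
have BF : ProperFilter (filter_from D B).
  apply: filter_from_proper => [|s /(grid_through ab)[N [X NXs]]].
    apply: filter_from_filter => [|s t sD tD]; first by exists [::].
    exists (s ++ t) => [x|NX [N0 gridX st]].
      by rewrite mem_cat => /orP[/sD|/tD].
    by split; split=> // x xs; apply: st; rewrite mem_cat xs ?orbT.
  by exists (N, X).
have [G [GU BG]] := ultraFilterLemma BF.
have GB s : D s -> G (B s) by move=> sD; apply: BG; exists s.
pose gX x (NX : T) := grid_positive_variation f NX.1 NX.2 x.
have /choice[g gP] x : exists l : R, gX x NX @[NX --> G] --> l.
  pose V := fine (joint_total_variation a b f).
  apply: (@ultra_bounded_cvg _ _ _ _ 0 V) => //.
  (* For the empty list, [B] only says that the index is a genuine grid. *)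
  apply: filterS (GB [::] _) => // -[N X] [/= N0 gridX _].
  have /andP[-> /= le_gv] :=
    grid_positive_variation_bound f x (N := N) (X := X).
  apply: (le_trans le_gv).
  have gv_le : ((grid_variation f N X)%:E <= joint_total_variation a b f)%E.
    by apply: ereal_sup_ubound; exists N, X.
  (* The total variation is finite: bounded above by hypothesis, and below by the real variation of
     this grid. *)
  rewrite -lee_fin /V fineK// fin_numElt bvf andbT.
  by rewrite (lt_le_trans _ gv_le)// ltNyr.
exists g => x y xab yab xy.
(* An increment is a finite linear combination of values, so pointwise convergence suffices. *)
have Dcvg :
    joint_increment (gX^~ NX) x y @[NX --> G] --> joint_increment g x y.
  rewrite /joint_increment; apply: cvg_big => [|eps _].
    exact: add_continuous.
  by apply: cvgMl_tmp; exact: gP.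
apply: cvgr_to_ge Dcvg _.
(* Along [G], both [x] and [y] are eventually grid points. *)
apply: filterS (GB [:: x; y] _) => [[N X] [/= N0 gridX xyX]|]; last first.
  by move=> z; rewrite !inE => /orP[] /eqP ->.
have xX : on_grid N X x by apply: xyX; rewrite !inE eqxx.
have yX : on_grid N X y by apply: xyX; rewrite !inE eqxx orbT.
rewrite ge_max joint_increment_grid_positive_variation_ge0//=.
exact: (joint_increment_grid_positive_variation_ge gridX).
Qed.

End Jordan.

Theorem theorem1p4 (R : realType) (n : nat) (hn : (1 <= n)%N)
    (a b : 'rV[R]_n) (hab : forall i : 'I_n, a 0 i < b 0 i)
    (f : 'rV[R]_n -> R) :
  joint_bounded_variation a b f <->
  exists g h : 'rV[R]_n -> R,
    [/\ jointly_increasing a b g, jointly_increasing a b h &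
        forall x : 'rV[R]_n, rect a b x -> f x = g x - h x].
Proof.
split=> [/(positive_variation_exists hab)[g gP]|]; last first.
  move=> [g [h [incg inch fE]]].
  exact: bounded_variation_of_difference incg inch fE.
exists g, (fun x => g x - f x); split=> [x y xab yab xy|x y xab yab xy|x _].
- by have := gP x y xab yab xy; rewrite ge_max => /andP[].
- rewrite joint_incrementB subr_ge0.
  by have := gP x y xab yab xy; rewrite ge_max => /andP[].
- by rewrite opprB addrC subrK.
Qed.
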